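(* In the setting of the context, suppose that the reinsurance premium is given by the variance premium principle $$q(t,y,u)=\mathbb E[Z]\lambda(t,y)u+\theta_r\mathbb E[Z^2]\lambda(t,y)u^2,\qquad(t,y,u)\in[0,T]\times\mathbb R\times[0,1],$$ for some constant $\theta_r>0$. Then the problem $\sup_{u\in[0,1]}\Psi^u(t,y)$ admits a unique maximizer $u^*(t)\in(0,1)$ (not depending on $y$) for all $(t,y)\in[0,T]\times\mathbb R$, which is the solution to $$2\theta_r\mathbb E[Z^2]u=\int_0^Dze^{\eta(1-u)ze^{R(T-t)}}\,dF_Z(z)-\mathbb E[Z].$$
   Context: Fix $T>0$, $R>0$, $\eta>0$, $D\in(0,+\infty]$. $\lambda:[0,T]\times\mathbb R\to(0,+\infty)$ is measurable. $Z$ is a strictly positive random variable with distribution function $F_Z$, $F_Z(z)=1$ for $z\ge D$, and $\mathbb E[e^{\eta Ze^{RT}}]$, $\mathbb E[Ze^{\eta Ze^{RT}}]$, $\mathbb E[Z^2e^{\eta Ze^{RT}}]$ are finite. $\Psi^u(t,y)=-\eta e^{R(T-t)}q(t,y,u)+\lambda(t,y)\int_0^D[1-e^{\eta(1-u)ze^{R(T-t)}}]\,dF_Z(z)$. *)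

(* Defs.v *)
From HB Require Import structures.
From mathcomp Require Import all_boot all_order all_algebra.
From mathcomp Require Import all_classical all_reals all_analysis.

Set Implicit Arguments.
Unset Strict Implicit.
Unset Printing Implicit Defensive.
Import Order.TTheory GRing.Theory Num.Theory.
Import numFieldNormedType.Exports.
Local Open Scope classical_set_scope.
Local Open Scope ring_scope.

(* The library's [cdf] is [\bar R]-valued, whereas a Lebesgue-Stieltjes measure
   is built from a real-valued cumulative function. *)
Definition df d (Omega : measurableType d) (R : realType)
  (P : probability Omega R) (Z : {RV P >-> R}) (z : R) : R := fine (cdf Z z).

Section df_cumulative.
Context d (Omega : measurableType d) (R : realType) (P : probability Omega R).
Variable Z : {RV P >-> R}.

Lemma df_nondecreasing : nondecreasing (df Z).
Proof.
by move=> x y xy; rewrite /df fine_le ?fin_num_measure// cdf_nondecreasing.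
Qed.

Lemma df_right_continuous : right_continuous (df Z).
Proof.
move=> a; apply: fine_cvg.
by rewrite fineK ?fin_num_measure//; exact: cdf_right_continuous.
Qed.

HB.instance Definition _ :=
  isCumulative.Build R _ R (df Z) df_nondecreasing df_right_continuous.

End df_cumulative.

(* [\int_0^D f(z) dF_Z(z)] as a Lebesgue-Stieltjes integral over the
   real points of (0, D]; [D] may be [+oo].  For a strictly positive [Z]
   the measure [dF_Z] has no atom at 0, so including 0 changes nothing. *)
Definition int0D d (Omega : measurableType d) (R : realType)
    (P : probability Omega R) (Z : {RV P >-> R}) (D : \bar R) (f : R -> R) :
    \bar R :=
  (\int[lebesgue_stieltjes_measure (df Z)]_(z in
     [set z : R | 0 < z%:E /\ z%:E <= D]) (f z)%:E)%E.

Definition Psi d (Omega : measurableType d) (R : realType)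
    (P : probability Omega R) (Z : {RV P >-> R}) (T r eta : R) (D : \bar R)
    (lambda : R -> R -> R) (q : R -> R -> R -> R) (u t y : R) : \bar R :=
  ((- eta * expR (r * (T - t)) * q t y u)%:E
   + (lambda t y)%:E
     * int0D Z D (fun z => 1 - expR (eta * (1 - u) * z * expR (r * (T - t))))%R)%E.

Definition is_maximizer (R : realType) (A : set R) (f : R -> \bar R) (x : R) :
    Prop :=
  A x /\ forall v, A v -> (f v <= f x)%E.

(* Main.v *)
(* Write M_n(c) = E[Z^n e^(cZ)].  Convexity of exp gives the tangent inequality
   M_{n+1}(c')(c - c') <= M_n(c) - M_n(c') without differentiating under the
   integral.  For n = 1 it makes c |-> M_1(c) Lipschitz and strictly increasing at
   0, so the first-order condition has a root u in (0,1) by the intermediate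
   value theorem.  For n = 0 it gives
   Psi^v <= Psi^u - eta e^(R(T-t)) lambda theta_r E[Z^2] (u - v)^2,
   so u is the unique maximizer. *)
From HB Require Import structures.
Require Import Defs.
From mathcomp Require Import all_boot all_order all_algebra.
From mathcomp Require Import all_classical all_reals all_analysis.
From mathcomp Require Import measurable_realfun ring lra.
Set Implicit Arguments.
Unset Strict Implicit.
Unset Printing Implicit Defensive.
Import Order.TTheory GRing.Theory Num.Theory.
Import numFieldNormedType.Exports.
Local Open Scope classical_set_scope.
Local Open Scope ring_scope.

(** * The Lebesgue-Stieltjes measure of [df Z] as the law of [Z] *)

Section borel_rv.
Context d (Omega : measurableType d) (R : realType) (P : probability Omega R).
Variable Z : {RV P >-> R}.

(* The library's theory of Lebesgue-Stieltjes measures lives on the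
   [measurableTypeR] copy of [R]. *)
Definition borel_rv : Omega -> measurableTypeR R := Z.

Lemma measurable_borel_rv : measurable_fun [set: Omega] borel_rv.
Proof. by move=> mD A mA; exact: (@measurable_funPT _ _ _ _ Z mD A mA). Qed.

HB.instance Definition _ :=
  isMeasurableFun.Build _ _ Omega (measurableTypeR R) borel_rv
    measurable_borel_rv.

(** A probability on the line is determined by its distribution function, and [df Z] is that of the
    law of [borel_rv]. *)
Lemma lebesgue_stieltjes_df (A : set R) : measurable A ->
  lebesgue_stieltjes_measure (df Z) A = distribution P borel_rv A.
Proof.
move=> mA.
exact: (@lebesgue_stieltjes_cdf_id R (distribution P borel_rv) A mA).
Qed.

Lemma integral_lebesgue_stieltjes_df (D : set R) (f : R -> \bar R) : 
  measurable D -> (\int[lebesgue_stieltjes_measure (df Z)]_(z in D) f z =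
  \int[distribution P borel_rv]_(z in D) f z)%E.
Proof.
move=> mD; apply: eq_measure_integral => A mA _.
exact: lebesgue_stieltjes_df.
Qed.
End borel_rv.

(** * Real analysis: solving the first-order condition and the gap it forces *)

Lemma klipschitz_within_continuous (R : realType) (f : R -> R) (A : set R)
    (k : R) :
  k.-lipschitz_A f -> {within A, continuous f}.
Proof.
move=> fk; apply/subspace_continuousP => x Ax.
apply/cvgrPdist_lt => e e0.
(* [k] may be zero or negative, so the positive constant |k| + 1 replaces it. *)
have k0 : 0 < `|k| + 1 by rewrite ltr_wpDl.
near=> y.
have Ay : A y by near: y; exact: withinT.
have xy : `|x - y| < e / (`|k| + 1).
  near: y; apply: cvg_within; apply/nbhs_ballP.
  by exists (e / (`|k| + 1)) => //=; rewrite divr_gt0.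
rewrite (le_lt_trans (fk (x, y) (conj Ax Ay)))//=.
rewrite ltr_pdivlMr// mulrC in xy.
apply: le_lt_trans xy; apply: ler_wpM2r => //.
by rewrite (le_trans (ler_norm k))// lerDl.
Unshelve. all: by end_near. Qed.

(** Applied with [a] = eta e^(r(T-t)), [K] = eta e^(rT), [b] = 2 theta_r E[Z^2] and the moments of
    order 1 and 2 as [M1], [M2]; the exponents [c <= K] are those where finiteness is known. *)
Lemma first_order_root (R : realType) (M1 M2 : R -> R) (K a b : R) :
  0 < a <= K -> 0 < b ->
  (forall c c', c <= K -> c' <= K -> M2 c' * (c - c') <= M1 c - M1 c') ->
  (forall c, c <= K -> 0 <= M2 c <= M2 K) -> 0 < M2 0 ->
  exists2 u : R, 0 < u < 1 & b * u = M1 (a * (1 - u)) - M1 0.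
Proof.
move=> /andP[a0 aK] b0 M1t M2K M20.
have aM2 : 0 <= a * M2 K.
  by apply: mulr_ge0; [exact: ltW|have /andP[] := M2K K (lexx _)].
have auK u : 0 <= u <= 1 -> a * (1 - u) <= K.
  by move=> /andP[u0 u1]; apply: le_trans aK; rewrite ler_piMr//; lra.
pose h u := b * u - M1 (a * (1 - u)).
have hlip : (b + a * M2 K).-lipschitz_`[0, 1] h.
  (* For u <= v, the tangents at both points place M1(a(1-u)) - M1(a(1-v)) between 0 and a M2(K) (v
     - u). *)
  have key u v : 0 <= u <= 1 -> 0 <= v <= 1 -> u <= v ->
      `|h u - h v| <= (b + a * M2 K) * `|u - v|.
    move=> u01 v01 uv; rewrite distrC [`|u - v|]distrC.
    rewrite [`|v - u|]ger0_norm ?subr_ge0//.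
    have t1 := M1t _ _ (auK u u01) (auK v v01).
    have t2 := M1t _ _ (auK v v01) (auK u u01).
    have m1 := M2K _ (auK u u01).
    have m2 := M2K _ (auK v v01).
    have bv : 0 <= b * (v - u) by rewrite mulr_ge0// ?subr_ge0// ltW.
    have av : 0 <= a * (v - u) by rewrite mulr_ge0// ?subr_ge0// ltW.
    have p1 : 0 <= M2 (a * (1 - v)) * (a * (v - u)) by apply: mulr_ge0; lra.
    have p2 : M2 (a * (1 - u)) * (a * (v - u)) <= M2 K * (a * (v - u)).
      by apply: ler_wpM2r => //; lra.
    by rewrite ler_norml /h; apply/andP; split; lra.
  move=> [u v] /= [/[!in_itv]/= u01 v01].
  have [uv|vu] := leP u v; first exact: key.
  by rewrite distrC [`|u - v|]distrC; apply: key => //; exact: ltW.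
have M1a : M1 0 < M1 a.
  rewrite -subr_gt0 (lt_le_trans _ (M1t a 0 aK _)) ?subr0 ?mulr_gt0//.
  by rewrite (le_trans _ aK)// ltW.
have h0 : h 0 = - M1 a by rewrite /h mulr0 subr0 mulr1 sub0r.
have h1 : h 1 = b - M1 0 by rewrite /h subrr mulr0 mulr1.
(* The level [- M1 0] lies strictly between [h 0] = -M1(a) and [h 1] = b - M1(0); strictness later
   excludes both endpoints. *)
have [|u] := IVT (v := - M1 0) ler01 (klipschitz_within_continuous hlip).
  by rewrite ge_min le_max h0 h1; apply/andP; split; apply/orP; [left|right]; lra.
rewrite in_itv/= => /andP[u0 u1] hu.
exists u; last by move: hu; rewrite /h; lra.
rewrite !lt_neqAle u0 u1 !andbT; apply/andP; split; apply/eqP => uE.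
  by move: hu; rewrite -uE h0; lra.
by move: hu; rewrite uE h1; lra.
Qed.

(** The first-order condition turns the tangent slope [m'] into [2 * c * u + m]; the terms in [m]
    then cancel, and (u^2 - v^2) - 2u(u - v) = -(u - v)^2 gives the gap. *)
Lemma quadratic_gap (R : realFieldType) (a l c m m' g g0 g' u v : R) :
  0 <= l -> 2 * c * u = m' - m ->
  m' * (a * (1 - v) - a * (1 - u)) <= g' - g ->
  - a * (m * (l * v) + c * (l * v ^+ 2)) + l * (g0 - g') <=
  - a * (m * (l * u) + c * (l * u ^+ 2)) + l * (g0 - g)
    - a * l * c * (u - v) ^+ 2.
Proof.
move=> l0 /eqP; rewrite eq_sym subr_eq => /eqP -> tan.
have : l * ((2 * c * u + m) * (a * (1 - v) - a * (1 - u))) <= l * (g' - g).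
  exact: ler_wpM2l.
by lra.
Qed.

(** * Exponential moments over a set on which [X] is positive *)

Section exponential_moments.
Context d (T : measurableType d) (R : realType).
Variables (mu : {measure set T -> \bar R}) (A : set T) (X : T -> R).
Hypothesis mA : measurable A.
Hypothesis mX : measurable_fun A X.
Hypothesis X_gt0 : forall w, A w -> 0 < X w.

(** A divergent integral would be read as 0 here, so comparisons of moments carry integrability
    hypotheses. *)
Definition moment n c := \int[mu]_(w in A) (X w ^+ n * expR (c * X w)).

Local Notation moment_integrable n c :=
  (mu.-integrable A (EFin \o (fun w => X w ^+ n * expR (c * X w)))).

Lemma measurable_moment n c :
  measurable_fun A (fun w => X w ^+ n * expR (c * X w)).
Proof.
apply: measurable_funM; first exact: measurable_funX.
by apply: measurableT_comp => //; exact: measurable_funM.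
Qed.

Lemma moment_integrableW n c c' : c <= c' ->
  moment_integrable n c' -> moment_integrable n c.
Proof.
move=> cc'; apply: le_integrable => //.
  by apply/measurable_EFinP; exact: measurable_moment.
move=> w Aw /=; have X0 := ltW (X_gt0 Aw).
rewrite lee_fin !ger0_norm ?mulr_ge0 ?exprn_ge0 ?expR_ge0//.
by rewrite ler_wpM2l ?exprn_ge0// ler_expR ler_wpM2r.
Qed.

Lemma le_moment n c c' : c <= c' -> moment_integrable n c' ->
  0 <= moment n c <= moment n c'.
Proof.
move=> cc' ic'; apply/andP; split.
  apply: Rintegral_ge0 => w /X_gt0/ltW X0.
  by rewrite mulr_ge0 ?exprn_ge0 ?expR_ge0.
apply: le_Rintegral => //; first exact: moment_integrableW ic'.
move=> w /X_gt0/ltW X0.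
by rewrite ler_wpM2l ?exprn_ge0// ler_expR ler_wpM2r.
Qed.

(* [moment n.+1] is the derivative of the convex function [moment n]. *)
Lemma moment_tangent n c c' :
  moment_integrable n c -> moment_integrable n c' -> moment_integrable n.+1 c' ->
  moment n.+1 c' * (c - c') <= moment n c - moment n c'.
Proof.
move=> ic ic' ic1'; rewrite /moment -RintegralZr// -RintegralB//.
apply: le_Rintegral => //.
- exact: (integrableZr mA (c - c') ic1').
- exact: (integrableB mA ic ic').
move=> w /X_gt0/ltW X0.
(* Factoring out X^n e^(c'X) leaves x <= e^x - 1 at x = (c - c')X, whatever the sign of c - c'. *)
have -> : X w ^+ n.+1 * expR (c' * X w) * (c - c') =
    X w ^+ n * (expR (c' * X w) * ((c - c') * X w)) by rewrite exprSr; ring.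
rewrite -mulrBr; apply: ler_wpM2l; first exact: exprn_ge0.
have -> : expR (c * X w) = expR (c' * X w) * expR ((c - c') * X w).
  by rewrite -expRD; congr expR; ring.
rewrite -[X in _ <= _ - X]mulr1 -mulrBr ler_wpM2l ?expR_ge0// lerBrDl.
exact: expR_ge1Dx.
Qed.

(** A nonnegative integrand with zero integral vanishes almost everywhere; this one is positive on
    all of [A], so [A] would be null. *)
Lemma moment_gt0 n c : (0 < mu A)%E -> moment_integrable n c -> 0 < moment n c.
Proof.
move=> muA ic; have /andP[m0 _] := le_moment (lexx c) ic.
rewrite lt_neqAle m0 andbT; apply/eqP => mE.
have pos w : A w -> 0 < X w ^+ n * expR (c * X w).
  by move=> /X_gt0 X0; rewrite mulr_gt0 ?exprn_gt0 ?expR_gt0.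
have [+ _] := ae_eq_integral_abs mu mA (measurable_int mu ic).
case.
  under eq_integral => w /[!inE] Aw.
    rewrite /= ger0_norm; last exact/ltW/pos.
    over.
  by rewrite -[LHS]fineK ?integrable_fin_num//; congr EFin; exact/esym/mE.
move=> N [mN N0 AN]; have : (mu A <= mu N)%E.
  apply: le_measure; rewrite ?inE// => w Aw; apply: AN => /= /(_ Aw)[] f0.
  by have := pos w Aw; rewrite f0 ltxx.
by rewrite N0 leNgt muA.
Qed.

End exponential_moments.

(** * The interval carrying the law of [Z], and integrals over it *)

Section claim_range.
Context d (Omega : measurableType d) (R : realType) (P : probability Omega R).
Variables (Z : {RV P >-> R}) (D : \bar R).
Hypothesis D_gt0 : (0 < D)%E.
Hypothesis Z_gt0 : {ae P, forall w, 0 < Z w}.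
Hypothesis df_D : forall z : R, (D <= z%:E)%E -> df Z z = 1.

Definition claim_range : set R := [set z | 0 < z%:E /\ z%:E <= D]%E.

Lemma claim_range_gt0 z : claim_range z -> 0 < z.
Proof. by rewrite -lte_fin => -[]. Qed.

Lemma measurable_claim_range : measurable claim_range.
Proof.
rewrite (_ : claim_range = EFin @^-1` `]0%E, D]%classic); last first.
  by apply/seteqP; split=> z /=; rewrite /claim_range/= in_itv/= => /andP.
by rewrite -[_ @^-1` _]setTI; apply: EFin_measurable => //; exact: emeasurable_itv.
Qed.

Lemma measurable_preimage_claim_range : measurable (Z @^-1` claim_range).
Proof. exact: measurable_funPTI measurable_claim_range. Qed.

(** The complement is covered by the event Z > D and a null set containing the event Z <= 0. *)
Lemma probability_claim_range : P (Z @^-1` claim_range) = 1%E.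
Proof.
suff : P (~` (Z @^-1` claim_range)) = 0%E.
  move=> B0; rewrite -[Z @^-1` _]setCK probability_setC ?B0 ?sube0//.
  exact/measurableC/measurable_preimage_claim_range.
(* For finite [D] this is 1 - F_Z(D) = 0; for [D] = +oo the event is empty. *)
have leD0 : P (Z @^-1` [set z | D < z%:E]%E) = 0%E.
  case: D D_gt0 df_D => [x x0 dfx|_ _|//].
  - have -> : [set z : R | x%:E < z%:E]%E = ~` `]-oo, x].
      apply/seteqP; split=> z /=; rewrite lte_fin in_itv/= real_leNgt ?num_real//.
      - by move=> ?; apply/negP; rewrite negbK.
      - by move/negP; rewrite negbK.
    rewrite -preimage_setC probability_setC; last first.
      by apply: (measurable_funPTI Z); exact: measurable_itv.
    rewrite -[X in (_ - X)%E]/(cdf Z x) -[cdf Z x]fineK ?fin_num_measure//.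
    by rewrite -/(df Z x) dfx// subee.
  - by rewrite (_ : _ @^-1` _ = set0) ?measure0//; apply/seteqP; split.
case: Z_gt0 => N [mN N0 ZN].
have mD : measurable (Z @^-1` [set z | D < z%:E]%E).
  apply: (measurable_funPTI Z).
  rewrite (_ : [set z | _] = EFin @^-1` `]D, +oo%E]%classic); last first.
    by apply/seteqP; split=> z /=; rewrite in_itv/= ?leey ?andbT.
  rewrite -[_ @^-1` _]setTI; apply: EFin_measurable => //.
  exact: emeasurable_itv.
apply/eqP; rewrite eq_le measure_ge0 andbT.
rewrite -(null_set_setU mN mD N0 leD0); apply: le_measure; rewrite ?inE.
- exact/measurableC/measurable_preimage_claim_range.
- exact: measurableU.
move=> w /= nB; have [Zw|Zw] := ltP 0 (Z w).
  by right; rewrite /= ltNge; apply/negP => ZD; apply: nB; rewrite /claim_range/= lte_fin.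
by left; apply: ZN => /=; rewrite ltNge Zw.
Qed.

(** The discarded event is null; on the remaining one [Z] is positive everywhere, not just almost
    everywhere. *)
Lemma expectation_claim_range (f : R -> R) : measurable_fun [set: R] f ->
  'E_P[f \o Z]%E = (\int[P]_(w in Z @^-1` claim_range) (f (Z w))%:E)%E.
Proof.
move=> mf; rewrite unlock [RHS]integral_mkcond.
have mB := measurable_preimage_claim_range.
have mfZ : measurable_fun [set: Omega] (fun w => (f (Z w))%:E).
  by apply/measurable_EFinP; exact: measurableT_comp.
apply: ae_eq_integral => //.
  by apply/(measurable_restrictT _ _).1 => //; exact: measurable_funTS.
exists (~` (Z @^-1` claim_range)); split; first exact: measurableC.
  by rewrite [LHS](probability_setC P mB) probability_claim_range subee.
move=> w /= + Bw; apply => _.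
by rewrite patchE mem_set.
Qed.

(** By nonnegativity on the range, the integral of the absolute value is the expectation itself. *)
Lemma integrable_claim_range (f : R -> R) : measurable_fun [set: R] f ->
  (forall z, claim_range z -> 0 <= f z) ->
  'E_P[f \o Z]%E \is a fin_num ->
  P.-integrable (Z @^-1` claim_range) (EFin \o (f \o Z)).
Proof.
move=> mf f0; rewrite expectation_claim_range// => ffin.
apply/integrableP; split.
  by apply/measurable_EFinP/measurable_funTS; exact: measurableT_comp.
under eq_integral => w /[!inE] Bw do rewrite /= ger0_norm ?f0//.
by rewrite ltey_eq ffin.
Qed.

(** Change of variables along [Z], since [df Z] induces its law. *)
Lemma int0D_claim_range (f : R -> R) : measurable_fun [set: R] f ->
  P.-integrable (Z @^-1` claim_range) (EFin \o (f \o Z)) ->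
  int0D Z D f = (\int[P]_(w in Z @^-1` claim_range) (f (Z w))%:E)%E.
Proof.
move=> mf intf; rewrite /int0D integral_lebesgue_stieltjes_df; last first.
  exact: measurable_claim_range.
rewrite integral_pushforward//; first exact/measurable_EFinP.
exact: measurable_claim_range.
Qed.

End claim_range.

(** * Existence, uniqueness and characterization of the optimal reinsurance level *)

Theorem lemma4p3 (R : realType) (d : measure_display) (Omega : measurableType d)
    (P : probability Omega R) (Z : {RV P >-> R}) (T r eta : R) (D : \bar R)
    (lambda : R -> R -> R) (q : R -> R -> R -> R) (theta_r : R) :
  0 < T -> 0 < r -> 0 < eta -> (0 < D)%E ->
  measurable_fun (`[0, T] `*` [set: R]) (fun p : R * R => lambda p.1 p.2) ->
  (forall t y : R, 0 <= t <= T -> 0 < lambda t y) ->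
  {ae P, forall w, 0 < Z w} ->
  (forall z : R, (D <= z%:E)%E -> df Z z = 1) ->
  ('E_P[(fun w => expR (eta * Z w * expR (r * T)))%R] \is a fin_num)%E ->
  ('E_P[(fun w => Z w * expR (eta * Z w * expR (r * T)))%R] \is a fin_num)%E ->
  ('E_P[(fun w => Z w ^+ 2 * expR (eta * Z w * expR (r * T)))%R] \is a fin_num)%E ->
  0 < theta_r ->
  (forall t y u : R, 0 <= t <= T -> 0 <= u <= 1 ->
     ((q t y u)%:E
      = 'E_P[Z] * (lambda t y * u)%:E
        + theta_r%:E * 'E_P[(fun w => Z w ^+ 2)%R] * (lambda t y * u ^+ 2)%:E)%E) ->
  exists ustar : R -> R, forall t : R, 0 <= t <= T ->
    [/\ 0 < ustar t < 1,
        forall y : R,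
          unique (is_maximizer `[0, 1]
                    (fun u => Psi Z T r eta D lambda q u t y)) (ustar t)
      & unique (fun u : R =>
          ((2 * theta_r)%:E * 'E_P[(fun w => Z w ^+ 2)%R] * u%:E
           = int0D Z D
               (fun z => z * expR (eta * (1 - u) * z * expR (r * (T - t))))%R
             - 'E_P[Z])%E) (ustar t)].
Proof.
move=> T0 r0 eta0 D0 _ lambda0 Z0 dfD E0 E1 E2 theta0 qE.
(* With the range condition on [t] moved under the existential, choice yields [ustar] on all of [R];
   outside [0, T] any value serves. *)
suff main (t : R) : exists u : R, 0 <= t <= T ->
    [/\ 0 < u < 1,
        forall y : R,
          unique (is_maximizer `[0, 1]
                    (fun u => Psi Z T r eta D lambda q u t y)) u
      & unique (fun u : R =>
          ((2 * theta_r)%:E * 'E_P[(fun w => Z w ^+ 2)%R] * u%:E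
           = int0D Z D
               (fun z => z * expR (eta * (1 - u) * z * expR (r * (T - t))))%R
             - 'E_P[Z])%E) u].
  by have [ustar ustarP] := choice main; exists ustar.
have [/andP[t0 tT]|nt] := boolP (0 <= t <= T); last first.
  by exists 0 => tT; case/negP: nt.
pose B := Z @^-1` claim_range D.
have mB : measurable B by exact: measurable_preimage_claim_range.
have mZ : measurable_fun B Z by exact: measurable_funTS.
have ZB w : B w -> 0 < Z w by move/claim_range_gt0.
(* The exponent in the moment hypotheses: finiteness at [K] passes to every smaller exponent. *)
pose K := eta * expR (r * T).
pose M := moment P B Z.
have mmom n c : measurable_fun [set: R] (fun z : R => z ^+ n * expR (c * z)).
  exact: (measurable_moment (@measurable_id _ _ setT)).
have intK n :
    'E_P[(fun w => Z w ^+ n * expR (eta * Z w * expR (r * T)))%R]%E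
      \is a fin_num ->
    forall c, c <= K ->
    P.-integrable B (EFin \o (fun w => Z w ^+ n * expR (c * Z w))).
  move=> En c cK; apply: (moment_integrableW mB mZ ZB cK).
  apply: (integrable_claim_range D0 Z0 dfD (mmom n K)).
    move=> z /claim_range_gt0 z0.
    by rewrite mulr_ge0 ?exprn_ge0 ?expR_ge0 ?ltW.
  rewrite (_ : _ \o _ = fun w => Z w ^+ n * expR (eta * Z w * expR (r * T)))//.
  by apply/funext => w /=; congr (_ * expR _); rewrite /K; ring.
have {E0} i0 : forall c, c <= K ->
    P.-integrable B (EFin \o (fun w => Z w ^+ 0 * expR (c * Z w))).
  apply: intK; rewrite (_ : (fun w => _) = fun w => expR (eta * Z w * expR (r * T)))//.
  by apply/funext => w; rewrite expr0 mul1r.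
have {E1} i1 : forall c, c <= K ->
    P.-integrable B (EFin \o (fun w => Z w ^+ 1 * expR (c * Z w))).
  exact: intK.
have {E2 intK} i2 := intK 2%N E2.
have K0 : 0 < K by rewrite mulr_gt0 ?expR_gt0.
have momE n c :
    P.-integrable B (EFin \o (fun w => Z w ^+ n * expR (c * Z w))) ->
    'E_P[(fun w => Z w ^+ n * expR (c * Z w))%R]%E = (M n c)%:E.
  move=> ic; rewrite (expectation_claim_range D0 Z0 dfD (mmom n c)).
  by rewrite -[LHS]fineK// integrable_fin_num.
have int0DE n c :
    P.-integrable B (EFin \o (fun w => Z w ^+ n * expR (c * Z w))) ->
    int0D Z D (fun z => z ^+ n * expR (c * z)) = (M n c)%:E.
  move=> ic; rewrite (int0D_claim_range (mmom n c))//.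
  by rewrite -[LHS]fineK// integrable_fin_num.
have EZ : 'E_P[Z]%E = (M 1%N 0)%:E.
  rewrite -momE; last exact/i1/ltW.
  by congr expectation; apply/funext => w; rewrite mul0r expR0 mulr1.
have EZ2 : 'E_P[(fun w => Z w ^+ 2)%R]%E = (M 2%N 0)%:E.
  rewrite -momE; last exact/i2/ltW.
  by congr expectation; apply/funext => w; rewrite mul0r expR0 mulr1.
pose a := eta * expR (r * (T - t)).
have aK : 0 < a <= K.
  rewrite mulr_gt0 ?expR_gt0//= ler_pM2l// ler_expR ler_pM2l//.
  by rewrite gerBl.
(* For u < 0 the exponent may exceed [K], so finiteness is no longer guaranteed. *)
have acK u : 0 <= u -> a * (1 - u) <= K.
  by case/andP: aK => a0 /(le_trans _) + u0; by apply; rewrite ger_pMr// gerBl.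
have S0 : 0 < M 2%N 0.
  apply: (moment_gt0 mB mZ ZB); last exact/i2/ltW.
  by rewrite [ltRHS](probability_claim_range D0 Z0 dfD) lte01.
have M1t c c' : c <= K -> c' <= K -> M 2%N c' * (c - c') <= M 1%N c - M 1%N c'.
  move=> cK c'K; apply: (moment_tangent mB ZB).
  - exact: i1.
  - exact: i1.
  - exact: i2.
have M0t c c' : c <= K -> c' <= K -> M 1%N c' * (c - c') <= M 0%N c - M 0%N c'.
  move=> cK c'K; apply: (moment_tangent mB ZB).
  - exact: i0.
  - exact: i0.
  - exact: i1.
have M2K c : c <= K -> 0 <= M 2%N c <= M 2%N K.
  by move=> cK; apply: (le_moment mB mZ ZB cK); exact: i2.
pose b := 2 * theta_r * M 2%N 0.
have b0 : 0 < b by rewrite !mulr_gt0.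
have [u u01 uE] := first_order_root aK b0 M1t M2K S0.
have {u01} [u0 u1] : 0 < u /\ u < 1 by apply/andP.
exists u => _; split; first by rewrite u0 u1.
- move=> y; have l0 := lambda0 t y (introT andP (conj t0 tT)).
  have a0 : 0 < a by case/andP: aK.
  (* Real-valued form of [Psi] on [0, 1]: its integral is a difference of moments of order 0. *)
  pose psi (v : R) : R := - a * (M 1%N 0 * (lambda t y * v)
      + theta_r * M 2%N 0 * (lambda t y * v ^+ 2))
    + lambda t y * (M 0%N 0 - M 0%N (a * (1 - v))).
  have PsiE (v : R) : 0 <= v <= 1 -> Psi Z T r eta D lambda q v t y = (psi v)%:E.
    move=> /andP[v0 v1]; rewrite /Psi.
    have -> : q t y v = M 1%N 0 * (lambda t y * v)
        + theta_r * M 2%N 0 * (lambda t y * v ^+ 2).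
      have := qE t y v; rewrite t0 tT v0 v1 => /(_ isT isT).
      by rewrite EZ EZ2 => -[].
    (* The constant 1 is written z^0 e^(0z), so that both terms are moment integrands. *)
    pose f z := z ^+ 0 * expR (0 * z) - z ^+ 0 * expR (a * (1 - v) * z) : R.
    rewrite (_ : (fun z => _) = f); last first.
      apply/funext => z; rewrite /f !expr0 !mul1r mul0r expR0.
      by congr (_ - expR _); rewrite /a; ring.
    have i00 := i0 0 (ltW K0).
    have i0v := i0 _ (acK v v0).
    rewrite (@int0D_claim_range _ _ _ _ _ _ f); last 2 first.
    - exact: measurable_funB.
    - exact: (integrableB mB i00 i0v).
    rewrite integralB_EFin//.
    rewrite -[X in (X - _)%E]fineK ?integrable_fin_num//.
    rewrite -[X in (_ - X)%E]fineK ?integrable_fin_num//.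
    by rewrite -EFinB -EFinM -EFinD /psi /a mulNr.
  (* The tangent to the moment of order 0 is taken at a(1-u), where the first-order condition gives
     its slope. *)
  have gap (v : R) : 0 <= v <= 1 ->
      psi v <= psi u - a * lambda t y * (theta_r * M 2%N 0) * (u - v) ^+ 2.
    move=> /andP[v0 v1].
    have tan := M0t _ _ (acK v v0) (acK u (ltW u0)).
    apply: quadratic_gap tan; first exact: ltW.
    by rewrite -uE /b mulrA.
  have c0 : 0 < a * lambda t y * (theta_r * M 2%N 0).
    exact: mulr_gt0 (mulr_gt0 a0 l0) (mulr_gt0 theta0 S0).
  have u01 : 0 <= u <= 1 by apply/andP; split; exact: ltW.
  split.
    split; first by rewrite /= in_itv.
    move=> v /=; rewrite in_itv/= => v01; rewrite (PsiE v v01) (PsiE u u01) lee_fin.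
    by rewrite (le_trans (gap v v01))// gerBl mulr_ge0 ?sqr_ge0// ltW.
  (* For another maximizer [v], psi(u) <= psi(v) together with [gap] forces (u - v)^2 <= 0. *)
  move=> v []; rewrite /= in_itv/= => v01 /(_ u); rewrite /= in_itv/= => /(_ u01).
  rewrite (PsiE v v01) (PsiE u u01) lee_fin => /le_trans/(_ (gap v v01)).
  rewrite lerBrDr gerDl pmulr_rle0// => uv.
  by apply/eqP; rewrite -subr_eq0 -sqrf_eq0 eq_le uv sqr_ge0.
(* Uniqueness of the root is over all real [v], so the sign of [v] must be settled before [F v] is
   known to be finite. *)
- pose F v := int0D Z D (fun z => z * expR (eta * (1 - v) * z * expR (r * (T - t)))).
  have FfunE v : (fun z : R => z * expR (eta * (1 - v) * z * expR (r * (T - t)))) =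
      (fun z => z ^+ 1 * expR (a * (1 - v) * z)).
    by apply/funext => z; congr (_ * expR _); rewrite /a; ring.
  have FE v : 0 <= v -> F v = (M 1%N (a * (1 - v)))%:E.
    by move=> v0; rewrite /F FfunE int0DE//; exact/i1/acK.
  have LE v : ((2 * theta_r)%:E * (M 2%N 0)%:E * v%:E)%E = (b * v)%:E by [].
  rewrite EZ EZ2; split.
    by rewrite -/(F u) FE ?ltW// LE uE.
  move=> v; rewrite -/(F v) LE => vE.
  (* For v < 0 the integral may be +oo, but it is still at least E[Z]. *)
  have v0 : 0 <= v.
    rewrite leNgt; apply/negP => v0.
    suff : (0 <= (b * v)%:E)%E by rewrite lee_fin leNgt pmulr_rlt0 ?v0.
    rewrite vE sube_ge0// -int0DE; last exact/i1/ltW.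
    rewrite /F FfunE /int0D.
    have mC := measurable_claim_range D.
    apply: ge0_le_integral => //.
    + by move=> z /claim_range_gt0 z0; rewrite lee_fin mulr_ge0 ?expR_ge0// ltW.
    + by apply/measurable_EFinP/measurable_funTS; exact: mmom.
    + by apply/measurable_EFinP/measurable_funTS; exact: mmom.
    move=> z /claim_range_gt0/ltW z0; rewrite lee_fin ler_wpM2l//.
    rewrite ler_expR mul0r; apply: mulr_ge0 => //; apply: mulr_ge0.
      by case/andP: aK => /ltW.
    by rewrite subr_ge0 (le_trans (ltW v0)).
  move: vE; rewrite FE// -EFinB => -[vE].
  have mono x y : x <= y -> y <= K -> M 1%N x <= M 1%N y.
    by move=> xy yK; have /andP[] := le_moment mB mZ ZB xy (i1 y yK).
  have amono x y : x <= y -> a * (1 - y) <= a * (1 - x).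
    by move=> xy; case/andP: aK => a0 _; rewrite ler_pM2l// lerD2l lerN2.
  (* In [v], the side b v increases while M1(a(1-v)) - M1(0) does not; comparing [u] with [v]
     squeezes b u and b v together. *)
  apply: (mulfI (lt0r_neq0 b0)); apply: le_anti.
  have [uv|/ltW vu] := leP u v.
    by rewrite ler_pM2l// uv/= uE vE lerD2r mono ?amono// acK// ltW.
  by rewrite [X in _ && X]ler_pM2l// vu andbT uE vE lerD2r mono ?amono// acK.
Qed.
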